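(* Let $k\ge 4$, and let $f$ be a three-translate on $\{1,\dots,3k\}$ which is a permutation. Then $\gamma(C(C_{3k},f))=2k=2\gamma(C_{3k})$ if and only if $\widetilde f$ is $(2,1,3)$ or $(1,3,2)$.
   Context: Let $G_1,G_2$ be disjoint copies of $C_{3k}$ with vertices $u_1,\dots,u_{3k}$ and $v_1,\dots,v_{3k}$ labeled cyclically; a function $f:\{1,\dots,3k\}\to\{1,\dots,3k\}$ is identified with the map $u_i\mapsto v_{f(i)}$. The functigraph $C(C_{3k},f)$ has vertex set $V(G_1)\cup V(G_2)$ and edge set $E(G_1)\cup E(G_2)\cup\{u_iv_{f(i)}: 1\le i\le 3k\}$. $f$ is a three-translate if $f(x+3i)=f(x)+3i$ for $x\in\{1,2,3\}$ and $i\in\{0,\dots,k-1\}$; $\widetilde f=f|_{\{1,2,3\}}$, and $\widetilde f=(a_1,a_2,a_3)$ means $\widetilde f(1)=a_1,\widetilde f(2)=a_2,\widetilde f(3)=a_3$. $\gamma$ denotes domination number. *)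

(* Defs.v *)
From mathcomp Require Import all_boot all_fingroup.
Set Implicit Arguments.
Unset Strict Implicit.
Unset Printing Implicit Defensive.

(* A finite graph is given by its adjacency relation on a finType. *)

Definition dominating (T : finType) (e : rel T) (D : {set T}) : bool :=
  [forall x, (x \in D) || [exists y in D, e y x]].

Lemma dominating_setT (T : finType) (e : rel T) : dominating e setT.
Proof. by apply/forallP => x; rewrite inE. Qed.

(* By dominating_setT the argument of the minimum is a dominating set. *)
Definition domination_number (T : finType) (e : rel T) : nat :=
  #|[arg min_(D < [set: T] | dominating e D) #|D|]|.

(* C_n on the vertices 0, ..., n-1, for n >= 3; ordS i is i+1 modulo n. *)
Definition cycle_graph (n : nat) : rel 'I_n :=
  fun i j => (j == ordS i) || (i == ordS j).

(* The vertex u_x is inl x and the vertex v_x is inr x. *)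
Definition functigraph (T : finType) (e : rel T) (f : T -> T) : rel (T + T) :=
  fun p q =>
    match p, q with
    | inl x, inl y => e x y
    | inr x, inr y => e x y
    | inl x, inr y => f x == y
    | inr y, inl x => f x == y
    end.

(* An ordinal i : 'I_n carries the label i.+1 in {1, ..., n}; [on_labels f] is
   f read on labels, and it takes the value 0 on numbers larger than n.  It is
   not meant to be applied to 0. *)
Definition on_labels (n : nat) (f : 'I_n -> 'I_n) (j : nat) : nat :=
  oapp (fun x : 'I_n => (f x).+1) 0 (insub j.-1).

Lemma on_labelsE (n : nat) (f : 'I_n -> 'I_n) (x : 'I_n) :
  on_labels f x.+1 = (f x).+1.
Proof. by rewrite /on_labels /= valK. Qed.

(* The addition f(x) + 3i is that of the integers, not modulo 3k. *)
Definition three_translate (k : nat) (f : 'I_(3 * k) -> 'I_(3 * k)) : Prop :=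
  forall x i : nat, 1 <= x <= 3 -> i < k ->
    on_labels f (x + 3 * i) = on_labels f x + 3 * i.

(* The restriction of f to the labels {1, 2, 3}, as the triple of its values. *)
Definition ftilde (n : nat) (f : 'I_n -> 'I_n) : nat * nat * nat :=
  (on_labels f 1, on_labels f 2, on_labels f 3).

(* Main.v *)
(* As f keeps values in [1, 3k], a permutation which is a three-translate permutes
   every block {3i+1, 3i+2, 3i+3} by the same s in S_3. Taking every third vertex
   of both cycles gives a dominating set of size 2k, for every s.

   For s = (2,1,3), the vertices u_1, u_2, v_1, v_2 of a block form a 4-cycle, in
   which u_1, v_1 see the edge u_3 v_3 of the previous block and u_2, v_2 see that
   of their own block. If a dominating set has q_i vertices in the i-th 4-cycle and
   e_i in the i-th edge, then 2 q_i + e_(i-1) + e_i >= 4 holds up to a correction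
   of the form phi_i - phi_(i-1), so that the sum over i of q_i + e_i is >= 2k.
   The case s = (1,3,2) is the previous one rotated by one step.

   For the other four s, a cyclic word of four special blocks with 7 vertices in
   total, followed by k - 4 copies of one block with 2 vertices, is dominating. *)
Require Import Defs.
From mathcomp Require Import all_boot all_fingroup.
From mathcomp Require Import zify.

Set Implicit Arguments.
Unset Strict Implicit.
Unset Printing Implicit Defensive.

(** * Domination numbers, periodic functions, and the lower bound for cycles *)

Lemma domination_number_le (T : finType) (e : rel T) (D : {set T}) :
  dominating e D -> domination_number e <= #|D|.
Proof.
move=> domD; rewrite /domination_number.
by case: arg_minnP => [|A _]; [exact: dominating_setT | apply].
Qed.

Lemma domination_number_ge (T : finType) (e : rel T) (m : nat) :
  (forall D : {set T}, dominating e D -> m <= #|D|) -> m <= domination_number e.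
Proof.
move=> le_m; rewrite /domination_number.
by case: arg_minnP => [|A /le_m //]; exact: dominating_setT.
Qed.

Lemma periodic_modn (T : Type) (F : nat -> T) (n i : nat) :
  (forall i, F (i + n) = F i) -> F (i %% n) = F i.
Proof.
move=> Fn; rewrite [in RHS](divn_eq i n) addnC.
by elim: (i %/ n) => [|q IHq]; rewrite ?addn0 // mulSn addnCA addnC Fn -IHq.
Qed.

Lemma sum_periodicS (F : nat -> nat) (n : nat) :
  (forall i, F (i + n) = F i) -> \sum_(i < n) F i.+1 = \sum_(i < n) F i.
Proof.
move=> Fn; apply: (@addnI (F 0)).
have := @big_ord_recl _ 0 addn n (fun i : 'I_n.+1 => F i).
by rewrite big_ord_recr /= addnC -[F n]/(F (0 + n)) Fn => ->.
Qed.

Lemma sum_blocks3 (F : nat -> nat) (k : nat) :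
  \sum_(n < 3 * k) F n = \sum_(i < k) (F (3 * i) + F (3 * i + 1) + F (3 * i + 2)).
Proof.
elim: k => [|k IHk]; first by rewrite muln0 !big_ord0.
by rewrite mulnS addnC addn3 !big_ord_recr /= IHk addn1 addn2 !addnA.
Qed.

Lemma modn_mul3D (k i j : nat) : j < 3 -> (3 * i + j) %% (3 * k) = 3 * (i %% k) + j.
Proof.
case: k => [|k] lt_j3; first by rewrite muln0 !modn0.
rewrite [in LHS](divn_eq i k.+1) mulnDr mulnCA -addnA modnMDl modn_small //.
have := ltn_pmod i (ltn0Sn k); lia.
Qed.

Lemma divn_mul3D (i j : nat) : j < 3 -> (3 * i + j) %/ 3 = i.
Proof. lia. Qed.

Lemma modn_mul3D_3 (i j : nat) : j < 3 -> (3 * i + j) %% 3 = j.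
Proof. lia. Qed.

Lemma cycle_graph_nbrE (n : nat) (P : pred 'I_n) (x : 'I_n) :
  [exists y, P y && cycle_graph y x] = P (ord_pred x) || P (ordS x).
Proof.
apply/existsP/orP => [[y /andP[Py /orP[]/eqP xy]]|[] Px].
- by left; rewrite xy ordSK.
- by right; rewrite -xy.
- by exists (ord_pred x); rewrite Px /cycle_graph ord_predK eqxx.
- by exists (ordS x); rewrite Px /cycle_graph eqxx orbT.
Qed.

(** Double counting: each closed neighbourhood meets [D], and each vertex of [D] lies in three of
    them. *)
Lemma cycle_graph_domination_ge (k : nat) :
  k <= domination_number (@cycle_graph (3 * k)).
Proof.
apply: domination_number_ge => D /forallP domD; rewrite -(leq_pmul2l (ltn0Sn 2)).
have cardD (h : 'I_(3 * k) -> 'I_(3 * k)) : injective h ->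
    \sum_(x < 3 * k) (h x \in D) = #|D|.
  move=> h_inj; rewrite -sum1_card [RHS]big_mkcond [RHS](reindex_inj h_inj).
  by apply: eq_bigr => x _; case: (_ \in D).
have -> : 3 * #|D| = \sum_(x < 3 * k)
    ((ord_pred x \in D) + (x \in D) + (ordS x \in D)).
  rewrite !big_split /= (cardD _ (@ord_pred_inj _)) (cardD _ (@ordS_inj _)).
  by have /= -> := cardD id (@inj_id _); move: #|D| => d; lia.
rewrite -[X in X <= _]card_ord -sum1_card; apply: leq_sum => x _.
have := domD x; rewrite cycle_graph_nbrE.
by case: (_ \in D); case: (_ \in D); case: (_ \in D).
Qed.

(** * Domination in the functigraph through periodic predicates *)

(** Predicates on [nat] let indices run past the end of a cycle; periodicity then replaces
    arithmetic modulo [3 * k]. *)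
Definition pair_set (n : nat) (U V : pred nat) : {set 'I_n + 'I_n} :=
  [set p : 'I_n + 'I_n | match p with inl x => U x | inr x => V x end].

Lemma card_pair_set (n : nat) (U V : pred nat) :
  #|pair_set n U V| = \sum_(i < n) (U i + V i).
Proof.
rewrite -sum1_card big_mkcond big_sumType /= big_split /=.
by congr (_ + _); apply: eq_bigr => i _; rewrite inE; case: ifP.
Qed.

(* The vertices of U in the blocks 1, 2, ... (labels counted from 0) are dominated;
   block 0 is left out to avoid the truncated predecessor of 0. For periodic U and
   V nothing is lost. *)
Definition dominated (s : nat -> nat) (U V : pred nat) : Prop :=
  forall i j, j < 3 ->
    [|| U (3 * i + j + 2), U (3 * i + j + 3), U (3 * i + j + 4)
      | V (3 * i + s j + 3)].

Lemma dominating_functigraphP (n : nat) (f : {perm 'I_n}) (U V : pred nat) :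
  reflect ((forall x : 'I_n, [|| U (ord_pred x), U x, U (ordS x) | V (f x)]) /\
           (forall x : 'I_n,
              [|| V (ord_pred x), V x, V (ordS x) | U ((f^-1)%g x)]))
    (dominating (functigraph (@cycle_graph n) f) (pair_set n U V)).
Proof.
have nbrl (x : 'I_n) :
    [exists y in pair_set n U V, functigraph (@cycle_graph n) f y (inl x)]
    = [|| U (ord_pred x), U (ordS x) | V (f x)].
  rewrite orbA -(cycle_graph_nbrE (fun y => U y)); apply/existsP/orP.
    case=> -[y|y] /andP[]; rewrite inE /= => Dy.
      by left; apply/existsP; exists y; rewrite Dy.
    by move/eqP->; right.
  case=> [/existsP[y Py]|Vfx]; first by exists (inl y); rewrite inE.
  by exists (inr (f x)); rewrite inE Vfx /=.
have nbrr (x : 'I_n) :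
    [exists y in pair_set n U V, functigraph (@cycle_graph n) f y (inr x)]
    = [|| V (ord_pred x), V (ordS x) | U ((f^-1)%g x)].
  rewrite orbA -(cycle_graph_nbrE (fun y => V y)); apply/existsP/orP.
    case=> -[y|y] /andP[]; rewrite inE /= => Dy.
      by move/eqP<-; right; rewrite permK.
    by left; apply/existsP; exists y; rewrite Dy.
  case=> [/existsP[y Py]|Ufx]; first by exists (inr y); rewrite inE.
  by exists (inl ((f^-1)%g x)); rewrite inE Ufx /= permKV.
apply: (iffP forallP) => [dom|[domU domV] [] x].
- split=> x.
    by have := dom (inl x); rewrite nbrl inE orbCA.
  by have := dom (inr x); rewrite nbrr inE orbCA.
- by rewrite nbrl inE orbCA; exact: domU.
- by rewrite nbrr inE orbCA; exact: domV.
Qed.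

Lemma dominatedP (k : nat) (f : 'I_(3 * k) -> 'I_(3 * k)) (s : nat -> nat)
    (U V : pred nat) :
  0 < k ->
  (forall i, U (i + 3 * k) = U i) -> (forall i, V (i + 3 * k) = V i) ->
  (forall j, j < 3 -> s j < 3) ->
  (forall x, f x = 3 * (x %/ 3) + s (x %% 3) :> nat) ->
  dominated s U V <->
  (forall x : 'I_(3 * k), [|| U (ord_pred x), U x, U (ordS x) | V (f x)]).
Proof.
move=> k_gt0 Uk Vk s3 fE; split=> [dom x|dom i j j3].
(* [dominated] speaks of block [i.+1], so [i.+1] is taken to be the block of [x] one period
   later. *)
- have := dom (x %/ 3 + k).-1 (x %% 3) (ltn_pmod x (ltn0Sn 2)).
  rewrite (periodic_modn _ Uk) (periodic_modn _ Uk) -(Uk x) -(Uk x.+1) -(Vk (f x)).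
  rewrite fE; set sj := s _.
  have -> : 3 * (x %/ 3 + k).-1 + x %% 3 + 2 = (x + 3 * k).-1 by lia.
  have -> : 3 * (x %/ 3 + k).-1 + x %% 3 + 3 = x + 3 * k by lia.
  have -> : 3 * (x %/ 3 + k).-1 + x %% 3 + 4 = x.+1 + 3 * k by lia.
  by have -> : 3 * (x %/ 3 + k).-1 + sj + 3 = 3 * (x %/ 3) + sj + 3 * k by lia.
- have N_gt0 : 0 < 3 * k by rewrite muln_gt0.
  have [n nE] : {n | n = 3 * i.+1 + j} by eexists.
  pose x := Ordinal (ltn_pmod n N_gt0).
  have Up : U (ord_pred x) = U n.-1.
    (* [ord_pred] adds a period before subtracting 1, hence the period added to [n.-1]. *)
    rewrite (periodic_modn _ Uk) -(Uk n.-1) -(periodic_modn (_ + _).-1 Uk) /=.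
    have -> : (n %% (3 * k) + 3 * k).-1 = n %% (3 * k) + (3 * k).-1 by lia.
    by rewrite modnDml (periodic_modn _ Uk); congr U; lia.
  have Us : U (ordS x) = U n.+1.
    rewrite (periodic_modn _ Uk) -(periodic_modn _.+1 Uk) /= -addn1 modnDml.
    by rewrite (periodic_modn _ Uk) addn1.
  have Vf : V (f x) = V (3 * i.+1 + s j).
    rewrite fE /= nE modn_mul3D // divn_mul3D // modn_mul3D_3 //.
    by rewrite -(periodic_modn (3 * i.+1 + _) Vk) modn_mul3D ?s3.
  have := dom x; rewrite Up Us Vf (periodic_modn _ Uk) nE.
  have -> : (3 * i.+1 + j).-1 = 3 * i + j + 2 by lia.
  have -> : 3 * i.+1 + j = 3 * i + j + 3 by lia.
  have -> : 3 * i.+1 + s j = 3 * i + s j + 3 by lia.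
  by rewrite -addnS.
Qed.

Lemma perm_iota_nth (n : nat) (s : seq nat) (j : nat) :
  perm_eq s (iota 0 n) -> j < n -> nth 0 s j < n.
Proof.
move=> s_perm jn; have : nth 0 s j \in s.
  by rewrite mem_nth // (perm_size s_perm) size_iota.
by rewrite (perm_mem s_perm) mem_iota.
Qed.

Lemma perm_iota_index (n : nat) (s : seq nat) (j : nat) :
  perm_eq s (iota 0 n) -> j < n -> index j s < n.
Proof.
move=> s_perm jn; have := index_mem j s.
by rewrite (perm_mem s_perm) mem_iota jn (perm_size s_perm) size_iota.
Qed.

(** As [s] lists 0, 1, 2 once each, [index^~ s] inverts [nth 0 s] within a block. *)
Lemma block_perm_inv (k : nat) (f : {perm 'I_(3 * k)}) (s : seq nat) :
  0 < k -> perm_eq s (iota 0 3) ->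
  (forall x, f x = 3 * (x %/ 3) + nth 0 s (x %% 3) :> nat) ->
  forall x, (f^-1)%g x = 3 * (x %/ 3) + index (x %% 3) s :> nat.
Proof.
move=> k_gt0 s_perm fE x.
have x_s : x %% 3 \in s by rewrite (perm_mem s_perm) mem_iota ltn_pmod.
have idx3 : index (x %% 3) s < 3 by rewrite perm_iota_index // ltn_pmod.
have y_lt : 3 * (x %/ 3) + index (x %% 3) s < 3 * k.
  have := ltn_ord x; lia.
have xE : f (Ordinal y_lt) = x.
  apply: val_inj; rewrite /= fE /= divn_mul3D // modn_mul3D_3 // nth_index //.
  by rewrite mulnC -divn_eq.
by rewrite -{1}xE permK.
Qed.

Lemma dominating_blocksP (k : nat) (f : {perm 'I_(3 * k)}) (s : seq nat)
    (U V : pred nat) :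
  0 < k -> perm_eq s (iota 0 3) ->
  (forall x, f x = 3 * (x %/ 3) + nth 0 s (x %% 3) :> nat) ->
  (forall i, U (i + 3 * k) = U i) -> (forall i, V (i + 3 * k) = V i) ->
  dominating (functigraph (@cycle_graph (3 * k)) f) (pair_set (3 * k) U V)
  <-> dominated (nth 0 s) U V /\ dominated (index^~ s) V U.
Proof.
move=> k_gt0 s_perm fE Uk Vk.
have s3 j := @perm_iota_nth 3 s j s_perm.
have t3 j := @perm_iota_index 3 s j s_perm.
have domU := dominatedP k_gt0 Uk Vk s3 fE.
have domV := dominatedP k_gt0 Vk Uk t3 (block_perm_inv k_gt0 s_perm fE).
split=> [/dominating_functigraphP[/domU ? /domV ?] //|[/domU ? /domV ?]].
exact/dominating_functigraphP.
Qed.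

(** * Reduction of a three-translate permutation to one permutation of a block *)

Lemma three_translate_perm (k : nat) (f : {perm 'I_(3 * k)}) :
  0 < k -> three_translate f ->
  exists s : seq nat,
    [/\ perm_eq s (iota 0 3),
        forall x, f x = 3 * (x %/ 3) + nth 0 s (x %% 3) :> nat
      & ftilde f = ((nth 0 s 0).+1, (nth 0 s 1).+1, (nth 0 s 2).+1)].
Proof.
move=> k_gt0 fT.
have o_lt i j : i < k -> j < 3 -> 3 * i + j < 3 * k by lia.
have [g gE] : {g : nat -> nat | forall j (j3 : j < 3),
    g j = f (Ordinal (o_lt 0 j k_gt0 j3))}.
  exists (fun j => (on_labels f j.+1).-1) => j j3.
  by rewrite -[j.+1]/(Ordinal (o_lt 0 j k_gt0 j3)).+1 on_labelsE.
have fE (x : 'I_(3 * k)) : f x = 3 * (x %/ 3) + g (x %% 3) :> nat.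
  have j3 : x %% 3 < 3 by rewrite ltn_pmod.
  have ik : x %/ 3 < k by have := ltn_ord x; lia.
  have := fT (x %% 3).+1 (x %/ 3) j3 ik.
  have -> : (x %% 3).+1 + 3 * (x %/ 3) = x.+1 by lia.
  rewrite -[(x %% 3).+1]/(Ordinal (o_lt 0 _ k_gt0 j3)).+1 !on_labelsE -gE; lia.
have g3 j : j < 3 -> g j < 3.
  (* In the last block, the non-modular addition leaves room below [3 * k] only if [g j < 3]. *)
  move=> j3; have k1 : k.-1 < k by rewrite prednK.
  have := fE (Ordinal (o_lt _ _ k1 j3)); rewrite /= divn_mul3D // modn_mul3D_3 //.
  have := ltn_ord (f (Ordinal (o_lt _ _ k1 j3))); lia.
have g_inj i j : i < 3 -> j < 3 -> g i = g j -> i = j.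
  move=> i3 j3; rewrite (gE _ i3) (gE _ j3) => /val_inj/perm_inj/(congr1 val) /=.
  by rewrite !add0n.
exists (mkseq g 3); split.
- have uniq_g : uniq (mkseq g 3).
    rewrite map_inj_in_uniq ?iota_uniq // => i j; rewrite !mem_iota; exact: g_inj.
  have g_sub : {subset mkseq g 3 <= iota 0 3}.
    by move=> x /mapP[j]; rewrite !mem_iota => /g3 ? ->.
  (* Three distinct values below 3 exhaust 0, 1, 2. *)
  apply: uniq_perm => //; exact: (uniq_min_size uniq_g g_sub isT).2.
- by move=> x; rewrite fE nth_mkseq // ltn_pmod.
- rewrite /ftilde !nth_mkseq //.
  have ftE j (j3 : j < 3) : on_labels f j.+1 = (g j).+1.
    by rewrite -[j.+1]/(Ordinal (o_lt 0 j k_gt0 j3)).+1 on_labelsE gE.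
  by rewrite !ftE.
Qed.

(** * Discharging: the lower bound for (2,1,3) and (1,3,2) *)

(* The correction phi at a cut is -1 when neither end of the edge is chosen nor the
   two vertices before it, and +1 when neither end is chosen nor the two vertices
   after it; the negative part is moved to the other side. *)
Lemma discharge_block (u v : pred nat) (s := nth 0 [:: 1; 0; 2]) :
  dominated s u v -> dominated s v u ->
  4 + ~~ [|| u 8, v 8, u 9 | v 9] + ~~ [|| u 4, v 4, u 5 | v 5] <=
    2 * (u 6 + u 7 + v 6 + v 7) + (u 5 + v 5) + (u 8 + v 8)
    + ~~ [|| u 7, v 7, u 8 | v 8] + ~~ [|| u 5, v 5, u 6 | v 6].
Proof.
(* The indices 6 and 7 carry the 4-cycle; 5 and 8 carry the edges on its two sides. *)
move=> domu domv.
have u5 : [|| u 4, u 5, u 6 | v 5] := domu 0 2 isT.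
have v5 : [|| v 4, v 5, v 6 | u 5] := domv 0 2 isT.
have u6 : [|| u 5, u 6, u 7 | v 7] := domu 1 0 isT.
have v6 : [|| v 5, v 6, v 7 | u 7] := domv 1 0 isT.
have u7 : [|| u 6, u 7, u 8 | v 6] := domu 1 1 isT.
have v7 : [|| v 6, v 7, v 8 | u 6] := domv 1 1 isT.
have u8 : [|| u 7, u 8, u 9 | v 8] := domu 1 2 isT.
have v8 : [|| v 7, v 8, v 9 | u 8] := domv 1 2 isT.
move: u6 v6 u7 v7 u5 v5 u8 v8; clear.
by case: (u 6); case: (v 6); case: (u 7); case: (v 7); case: (u 5); case: (v 5);
  case: (u 8); case: (v 8) => //=;
  case: (u 4); case: (v 4) => //=; case: (u 9); case: (v 9).
Qed.

(** Over a full period the shifts disappear, so the corrections [A] and [B] cancel, and each edge is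
    counted twice, once from either side. *)
Lemma sum_discharge (k : nat) (Q E A B : nat -> nat) :
  (forall i, Q (i + k) = Q i) -> (forall i, E (i + k) = E i) ->
  (forall i, A (i + k) = A i) -> (forall i, B (i + k) = B i) ->
  (forall i, 4 + B i.+2 + A i.+1 <=
    2 * Q i.+2 + E i.+1 + E i.+2 + A i.+2 + B i.+1) ->
  4 * k <= 2 * (\sum_(i < k) Q i + \sum_(i < k) E i).
Proof.
move=> Qk Ek Ak Bk charge.
have sumSS F : (forall i, F (i + k) = F i) ->
    \sum_(i < k) F i.+2 = \sum_(i < k) F i.
  move=> Fk; rewrite -[RHS](sum_periodicS Fk).
  by apply: (@sum_periodicS (fun i => F i.+1)) => i; rewrite -addSn.
have : \sum_(i < k) (4 + B i.+2 + A i.+1) <=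
    \sum_(i < k) (2 * Q i.+2 + E i.+1 + E i.+2 + A i.+2 + B i.+1).
  by apply: leq_sum => i _; exact: charge.
rewrite !big_split /= big1_eq (sumSS _ Qk) (sumSS _ Ek) (sumSS _ Ak).
rewrite (sumSS _ Bk) (sum_periodicS Ak) (sum_periodicS Bk) (sum_periodicS Ek).
rewrite sum_nat_const card_ord.
move: (\sum_(i < k) Q i) (\sum_(i < k) E i) => q e.
move: (\sum_(i < k) A i) (\sum_(i < k) B i) => a b; lia.
Qed.

Lemma dominated_swap_sum (k : nat) (U V : pred nat) (s := nth 0 [:: 1; 0; 2]) :
  (forall i, U (i + 3 * k) = U i) -> (forall i, V (i + 3 * k) = V i) ->
  dominated s U V -> dominated s V U -> 2 * k <= \sum_(n < 3 * k) (U n + V n).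
Proof.
move=> Uk Vk domU domV; rewrite (sum_blocks3 (fun n => U n + V n)).
(* [Q i] and [E i] count the chosen vertices of the 4-cycle and of the edge in block [i]; the
   correction phi at that edge is [B i] minus [A i]. *)
pose Q i := U (3 * i) + U (3 * i + 1) + V (3 * i) + V (3 * i + 1).
pose E i := U (3 * i + 2) + V (3 * i + 2).
pose A i : nat := ~~ [|| U (3 * i + 1), V (3 * i + 1), U (3 * i + 2) | V (3 * i + 2)].
pose B i : nat := ~~ [|| U (3 * i + 2), V (3 * i + 2), U (3 * i + 3) | V (3 * i + 3)].
have charge i : 4 + B i.+2 + A i.+1 <=
    2 * Q i.+2 + E i.+1 + E i.+2 + A i.+2 + B i.+1.
  (* Translation by whole blocks preserves domination, so the inequality around block 2 yields the
     one around block [i.+2]. *)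
  have dom (W X : pred nat) : dominated s W X ->
      dominated s (fun j => W (3 * i + j)) (fun j => X (3 * i + j)).
    by move=> domW a j /(domW (i + a) j); rewrite mulnDr -!addnA.
  have := discharge_block (dom _ _ domU) (dom _ _ domV).
  have e1 j : 3 * i.+1 + j = 3 * i + (3 + j) by lia.
  have e2 j : 3 * i.+2 + j = 3 * i + (6 + j) by lia.
  by rewrite /A /B /Q /E !e1 !e2 -[3 * i.+2]addn0 !e2.
have per (W : pred nat) : (forall i, W (i + 3 * k) = W i) ->
    forall i j, W (3 * (i + k) + j) = W (3 * i + j).
  by move=> Wk i j; rewrite mulnDr addnAC Wk.
have perU := per _ Uk; have perV := per _ Vk.
have Qk i : Q (i + k) = Q i by rewrite /Q !perU !perV mulnDr Uk Vk.
have Ek i : E (i + k) = E i by rewrite /E !perU !perV.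
have Ak i : A (i + k) = A i by rewrite /A !perU !perV.
have Bk i : B (i + k) = B i by rewrite /B !perU !perV.
have := sum_discharge Qk Ek Ak Bk charge; rewrite -[4]/(2 * 2) -mulnA leq_pmul2l //.
move/leq_trans; apply; rewrite -big_split /=; apply: eq_leq.
by apply: eq_bigr => i _; rewrite /Q /E; lia.
Qed.

(** Read from the second label on, the swapped labels 2, 3 come first in a block, and the fixed
    label 1 of the next block comes third. *)
Lemma dominated_shift (U V : pred nat) :
  dominated (nth 0 [:: 0; 2; 1]) U V ->
  dominated (nth 0 [:: 1; 0; 2]) (fun n => U n.+1) (fun n => V n.+1).
Proof.
move=> dom i [|[|[|]]] // _.
- by have := dom i 1 isT; rewrite /= !addn0 -!addnA -!addnS.
- by have := dom i 2 isT; rewrite /= !addn0 -!addnA -!addnS.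
- by have := dom i.+1 0 isT; rewrite mulnSr /= !addn0 -!addnA -!addnS.
Qed.

Lemma eq_dominated (s t : nat -> nat) (U V : pred nat) :
  (forall j, j < 3 -> s j = t j) -> dominated s U V -> dominated t U V.
Proof. by move=> st dom i j j3; rewrite -st //; exact: dom. Qed.

Lemma sum_dominated_ge (k : nat) (s : seq nat) (U V : pred nat) :
  s = [:: 1; 0; 2] \/ s = [:: 0; 2; 1] ->
  (forall i, U (i + 3 * k) = U i) -> (forall i, V (i + 3 * k) = V i) ->
  dominated (nth 0 s) U V -> dominated (index^~ s) V U ->
  2 * k <= \sum_(n < 3 * k) (U n + V n).
Proof.
move=> sE Uk Vk domU domV.
(* Both transpositions are involutions, so [index^~ s] agrees with [nth 0 s]. *)
have {}domV : dominated (nth 0 s) V U.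
  by apply: eq_dominated domV; case: sE => -> [|[|[|]]].
case: sE domU domV => -> domU domV; first exact: dominated_swap_sum.
rewrite -(@sum_periodicS (fun n => U n + V n)) => [|i]; last by rewrite Uk Vk.
by apply: dominated_swap_sum (dominated_shift domU) (dominated_shift domV) => i;
  rewrite -addSn.
Qed.

(** * Dominating sets from cyclic words of blocks *)

(* The letters of a word over blocks list the membership of u_1, u_2, u_3, v_1, v_2
   and v_3; the offset [o] is 0 for the u's and 3 for the v's. The word is [B]
   followed by copies of [c] up to length [k], repeated periodically. *)
Definition pattern (k : nat) (c : seq bool) (B : seq (seq bool)) (o n : nat) : bool :=
  nth false (nth c B (n %/ 3 %% k)) (n %% 3 + o).

Lemma pattern_periodic (k : nat) (c : seq bool) (B : seq (seq bool)) (o n : nat) :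
  pattern k c B o (n + 3 * k) = pattern k c B o n.
Proof.
rewrite /pattern.
have -> : (n + 3 * k) %/ 3 = n %/ 3 + k by lia.
have -> : (n + 3 * k) %% 3 = n %% 3 by lia.
by rewrite modnDr.
Qed.

Lemma pattern_mul3D (k : nat) (c : seq bool) (B : seq (seq bool)) (o i j : nat) :
  j < 3 -> pattern k c B o (3 * i + j) = nth false (nth c B (i %% k)) (j + o).
Proof. by move=> j3; rewrite /pattern divn_mul3D // modn_mul3D_3. Qed.

(** Tests the middle one of three consecutive blocks, as a boolean so that words can be checked by
    computation; [o] selects the cycle to be dominated, [o'] the other one. *)
Definition block_dominated (s : nat -> nat) (o o' : nat) (w : seq (seq bool)) : bool :=
  let b i j := nth false (nth [::] w i) (j + o) in
  [&& [|| b 0 2, b 1 0, b 1 1 | nth false (nth [::] w 1) (s 0 + o')],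
      [|| b 1 0, b 1 1, b 1 2 | nth false (nth [::] w 1) (s 1 + o')]
    & [|| b 1 1, b 1 2, b 2 0 | nth false (nth [::] w 1) (s 2 + o')]].

Lemma pattern_dominated (k : nat) (c : seq bool) (B : seq (seq bool))
    (s : nat -> nat) (o o' : nat) (b := fun i => nth c B (i %% k)) :
  (forall j, j < 3 -> s j < 3) ->
  (forall i, block_dominated s o o' [:: b i; b i.+1; b i.+2]) ->
  dominated s (pattern k c B o) (pattern k c B o').
Proof.
move=> s3 ok i j j3.
have -> : 3 * i + s j + 3 = 3 * i.+1 + s j by lia.
rewrite [pattern _ _ _ o' _]pattern_mul3D ?s3 //.
case/and3P: (ok i); case: j j3 => [|[|[|]]] // _ /=.
- have -> : 3 * i + 0 + 2 = 3 * i + 2 by lia.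
  have -> : 3 * i + 0 + 3 = 3 * i.+1 + 0 by lia.
  have -> : 3 * i + 0 + 4 = 3 * i.+1 + 1 by lia.
  by rewrite !pattern_mul3D.
- have -> : 3 * i + 1 + 2 = 3 * i.+1 + 0 by lia.
  have -> : 3 * i + 1 + 3 = 3 * i.+1 + 1 by lia.
  have -> : 3 * i + 1 + 4 = 3 * i.+1 + 2 by lia.
  by rewrite !pattern_mul3D.
- have -> : 3 * i + 2 + 2 = 3 * i.+1 + 1 by lia.
  have -> : 3 * i + 2 + 3 = 3 * i.+1 + 2 by lia.
  have -> : 3 * i + 2 + 4 = 3 * i.+2 + 0 by lia.
  by rewrite !pattern_mul3D.
Qed.

(* The triples of consecutive blocks of a cyclic word [b0 b1 b2 b3 c ... c] with
   at least four letters. *)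
Definition windows (T : Type) (c b0 b1 b2 b3 : T) : seq (seq T) :=
  [:: [:: b3; b0; b1]; [:: c; b0; b1]; [:: b0; b1; b2]; [:: b1; b2; b3];
      [:: b2; b3; b0]; [:: b2; b3; c]; [:: b3; c; c]; [:: b3; c; b0];
      [:: c; c; c]; [:: c; c; b0]].

(** One finite list serves all [k >= 4]: [[:: b3; b0; b1]] and [[:: b2; b3; b0]] arise for [k = 4],
    [[:: b3; c; b0]] for [k = 5], and [[:: c; c; c]] from [k = 7] on. *)
Lemma mem_windows (T : eqType) (c b0 b1 b2 b3 : T) (k i : nat)
    (b := fun i => nth c [:: b0; b1; b2; b3] (i %% k)) :
  4 <= k -> [:: b i; b i.+1; b i.+2] \in windows c b0 b1 b2 b3.
Proof.
move=> k4.
have modS n : n.+1 %% k = if (n %% k).+1 == k then 0 else (n %% k).+1.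
  case: eqP => [kE|kN]; first by rewrite -addn1 -modnDml addn1 kE modnn.
  rewrite -addn1 -modnDml addn1 modn_small //.
  have := ltn_pmod n (ltnW (ltnW (ltnW k4))); lia.
rewrite /b !modS; move: (i %% k) => {modS b} m; case: k k4 => [|[|[|[|k]]]] // _.
(* Here [k] has become the number of fillers, and [m] is the position of the first block of the
   window; the tests against [k] decide where the word wraps around. *)
case: m => [|[|[|[|m]]]]; rewrite !eqSS /=.
- by rewrite !inE eqxx !orbT.
- by rewrite !inE eqxx !orbT.
- by case: eqP => _ /=; rewrite !inE eqxx ?orbT.
- case: (0 =P k) => [<-|_]; first by rewrite !inE eqxx ?orbT.
  by rewrite /= !eqSS; case: eqP => _ /=; rewrite !inE eqxx ?orbT.
- case: (m.+1 =P k) => [<-|_] /=; first by rewrite nth_nil !inE eqxx ?orbT.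
  by rewrite !eqSS; case: eqP => _ /=; rewrite !nth_nil !inE eqxx ?orbT.
Qed.

Lemma sum_nth_default (T : Type) (F : T -> nat) (c : T) (B : seq T) (k : nat) :
  size B <= k ->
  \sum_(i < k) F (nth c B i) = \sum_(b <- B) F b + (k - size B) * F c.
Proof.
elim: B k => [|b B IHB] k.
  rewrite big_nil subn0 => _; under eq_bigr do rewrite nth_nil.
  by rewrite sum_nat_const card_ord.
by case: k => // k /IHB IHk; rewrite big_ord_recl big_cons /= IHk addnA.
Qed.

(* The filler block comes first in [w]; 9 = 7 + 2. *)
Definition good_word (s : seq nat) (w : seq (seq bool)) : bool :=
  if w is [:: c; b0; b1; b2; b3] then
    [&& all (fun x => block_dominated (nth 0 s) 0 3 x &&
                      block_dominated (index^~ s) 3 0 x) (windows c b0 b1 b2 b3),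
        sumn (map (count id) w) == 9, count id c == 2
      & all (fun b => size b == 6) w]
  else false.

(** The special blocks contribute 7 vertices and the [k - 4] fillers 2 each, which makes
    [2 * k - 1]. *)
Lemma good_word_domination_lt (k : nat) (f : {perm 'I_(3 * k)}) (s : seq nat)
    (w : seq (seq bool)) :
  4 <= k -> perm_eq s (iota 0 3) ->
  (forall x, f x = 3 * (x %/ 3) + nth 0 s (x %% 3) :> nat) ->
  good_word s w ->
  domination_number (functigraph (@cycle_graph (3 * k)) f) < 2 * k.
Proof.
move=> k4 s_perm fE; have k_gt0 : 0 < k by exact: leq_trans k4.
case: w => [|c [|b0 [|b1 [|b2 [|b3 []]]]]] //.
case/and4P=> /allP okw /eqP sum9 /eqP c2 /allP size6.
set B := [:: b0; b1; b2; b3].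
pose U := pattern k c B 0; pose V := pattern k c B 3.
have s3 j := @perm_iota_nth 3 s j s_perm.
have t3 j := @perm_iota_index 3 s j s_perm.
have dom : dominating (functigraph (@cycle_graph (3 * k)) f) (pair_set (3 * k) U V).
  apply/(dominating_blocksP k_gt0 s_perm fE); try exact: pattern_periodic.
  by split; apply: pattern_dominated => // i;
    case/andP: (okw _ (mem_windows c b0 b1 b2 b3 i k4)).
apply: leq_ltn_trans (domination_number_le dom) _.
rewrite card_pair_set (sum_blocks3 (fun n => U n + V n)).
have blockE (i : 'I_k) : (U (3 * i) + V (3 * i)) + (U (3 * i + 1) + V (3 * i + 1))
    + (U (3 * i + 2) + V (3 * i + 2)) = count id (nth c B i).
  rewrite -{1 2}[3 * i]addn0 /U /V !pattern_mul3D // modn_small //.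
  have /size6 : nth c B i \in [:: c; b0; b1; b2; b3].
    case: (ltnP i 4) => iB; last by rewrite nth_default ?mem_head.
    by rewrite inE orbC (mem_nth c (iB : i < size B)).
  (* A block has exactly six letters, the ones read by [U] and [V]. *)
  by case: (nth c B i) => [|x0 [|x1 [|x2 [|x3 [|x4 [|x5 []]]]]]] //= _; lia.
under eq_bigr do rewrite blockE.
rewrite (sum_nth_default (count id)) // !big_cons big_nil c2 /=.
move: sum9; rewrite /= c2; lia.
Qed.

(** * Domination numbers of the functigraph and of the cycle *)

Lemma functigraph_domination_le (k : nat) (f : {perm 'I_(3 * k)}) (s : seq nat) :
  0 < k -> perm_eq s (iota 0 3) ->
  (forall x, f x = 3 * (x %/ 3) + nth 0 s (x %% 3) :> nat) ->
  domination_number (functigraph (@cycle_graph (3 * k)) f) <= 2 * k.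
Proof.
move=> k_gt0 s_perm fE; pose U n := n %% 3 == 0.
have Uk i : U (i + 3 * k) = U i by rewrite /U mulnC addnC modnMDl.
(* Every vertex is dominated within its own cycle, so [t] is arbitrary. *)
have domU t : dominated t U U.
  by move=> i [|[|[|]]] // _; apply/or4P;
    [constructor 2|constructor 1|constructor 3]; rewrite /U; lia.
have dom : dominating (functigraph (@cycle_graph (3 * k)) f) (pair_set (3 * k) U U).
  exact/(dominating_blocksP k_gt0 s_perm fE).
apply: leq_trans (domination_number_le dom) _.
rewrite card_pair_set (sum_blocks3 (fun n => U n + U n)) mulnC.
rewrite -[X in _ <= X * _]card_ord -sum_nat_const; apply: leq_sum => i _.
rewrite /U; lia.
Qed.

Lemma cycle_graph_domination (k : nat) :
  0 < k -> domination_number (@cycle_graph (3 * k)) = k.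
Proof.
move=> k_gt0; apply/eqP; rewrite eqn_leq cycle_graph_domination_ge andbT.
pose D := [set x : 'I_(3 * k) | x %% 3 == 0].
have dom : dominating (@cycle_graph (3 * k)) D.
  apply/forallP => x; rewrite cycle_graph_nbrE !inE /=.
  (* Since 3 divides [3 * k], wrapping around keeps residues modulo 3. *)
  have mod3 n : n %% (3 * k) %% 3 = n %% 3 by rewrite modn_dvdm ?dvdn_mulr.
  rewrite !mod3; have := ltn_ord x; lia.
apply: leq_trans (domination_number_le dom) _.
rewrite -sum1_card big_mkcond /=.
under eq_bigr do rewrite inE.
rewrite (sum_blocks3 (fun n => if n %% 3 == 0 then 1 else 0)).
rewrite -[X in _ <= X]card_ord -sum1_card; apply: leq_sum => i _.
by rewrite -{1}[3 * i]addn0 !modn_mul3D_3.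
Qed.

Lemma functigraph_domination_ge (k : nat) (f : {perm 'I_(3 * k)}) (s : seq nat) :
  0 < k -> s = [:: 1; 0; 2] \/ s = [:: 0; 2; 1] ->
  (forall x, f x = 3 * (x %/ 3) + nth 0 s (x %% 3) :> nat) ->
  2 * k <= domination_number (functigraph (@cycle_graph (3 * k)) f).
Proof.
move=> k_gt0 sE fE; apply: domination_number_ge => D domD.
have s_perm : perm_eq s (iota 0 3) by case: sE => ->.
have N_gt0 : 0 < 3 * k by rewrite muln_gt0.
(* Reduction modulo [3 * k] turns any vertex set [D] into two periodic predicates. *)
pose o n : 'I_(3 * k) := Ordinal (ltn_pmod n N_gt0).
pose U n := inl (o n) \in D; pose V n := inr (o n) \in D.
have ok n : o (n + 3 * k) = o n by apply: val_inj; rewrite /= modnDr.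
have oK (x : 'I_(3 * k)) : o x = x by apply: val_inj; rewrite /= modn_small.
have Uk n : U (n + 3 * k) = U n by rewrite /U ok.
have Vk n : V (n + 3 * k) = V n by rewrite /V ok.
have DE : D = pair_set (3 * k) U V.
  by apply/setP => -[] x; rewrite inE /U /V oK.
move: domD; rewrite DE card_pair_set.
by case/(dominating_blocksP k_gt0 s_perm fE Uk Vk) => domU domV;
  exact: sum_dominated_ge sE Uk Vk domU domV.
Qed.

Theorem theorem4p11 (k : nat) (hk : 4 <= k) (f : {perm 'I_(3 * k)})
    (hf : three_translate f) :
  (domination_number (functigraph (@cycle_graph (3 * k)) f) = 2 * k /\
   2 * k = 2 * domination_number (@cycle_graph (3 * k)))
  <-> (ftilde f = (2, 1, 3) \/ ftilde f = (1, 3, 2)).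
Proof.
have k_gt0 : 0 < k by exact: leq_trans hk.
have [s [s_perm fE ->]] := three_translate_perm k_gt0 hf.
have bad w : good_word s w ->
    domination_number (functigraph (@cycle_graph (3 * k)) f) <> 2 * k.
  by move/(good_word_domination_lt hk s_perm fE) => lt2k eq2k; rewrite eq2k ltnn in lt2k.
(* The words below were found by computer search. *)
pose word := map (map (leq 1)).
split=> [[eq2k _]|sE].
  have : s \in permutations (iota 0 3) by rewrite mem_permutations.
  have -> : permutations (iota 0 3) = [:: [:: 1; 0; 2]; [:: 0; 1; 2]; [:: 2; 0; 1];
      [:: 0; 2; 1]; [:: 1; 2; 0]; [:: 2; 1; 0]] by [].
  rewrite !inE => /or4P[|||/or3P[]] /eqP sE; rewrite sE /=; try by [left|right].
  (* The remaining [s] are, in order, the identity, the two 3-cycles and the transposition (3,2,1);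
     the filler is always u_1, v_1. *)
  - case: (bad (word [:: [:: 1; 0; 0; 1; 0; 0]; [:: 1; 0; 0; 1; 0; 1]; [:: 0; 1; 0; 0; 0; 0];
      [:: 0; 0; 1; 1; 0; 0]; [:: 0; 0; 0; 0; 1; 0]])) => //.
    by rewrite sE.
  - case: (bad (word [:: [:: 1; 0; 0; 1; 0; 0]; [:: 1; 0; 0; 1; 0; 0]; [:: 1; 0; 0; 0; 1; 0];
      [:: 0; 1; 1; 0; 0; 0]; [:: 0; 0; 0; 1; 0; 0]])) => //.
    by rewrite sE.
  - case: (bad (word [:: [:: 1; 0; 0; 1; 0; 0]; [:: 0; 1; 0; 1; 0; 0]; [:: 0; 0; 0; 0; 1; 1];
      [:: 1; 0; 0; 0; 0; 0]; [:: 1; 0; 0; 1; 0; 0]])) => //.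
    by rewrite sE.
  - case: (bad (word [:: [:: 1; 0; 0; 1; 0; 0]; [:: 0; 0; 1; 0; 0; 1]; [:: 0; 0; 0; 0; 1; 0];
      [:: 1; 0; 0; 1; 0; 0]; [:: 1; 0; 0; 1; 0; 0]])) => //.
    by rewrite sE.
have {}sE : s = [:: 1; 0; 2] \/ s = [:: 0; 2; 1].
  move: (perm_size s_perm) sE.
  by case: (s) => [|a [|b [|c []]]] //= _ [[-> -> ->]|[-> -> ->]]; [left|right].
split; last by rewrite cycle_graph_domination.
apply/eqP; rewrite eqn_leq (functigraph_domination_le k_gt0 s_perm fE).
exact: functigraph_domination_ge sE fE.
Qed.
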